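(* Let $k\ge2$ and $r\ge 2$ be integers and let $q=\frac{r^k-1}{r-1}$. Every $k$-uniform hypergraph $G$ with $m$ edges contains a subhypergraph with at least $\frac{1}{2\,k!}m^{(q-1)/q}$ edges which contains no copy of $K^{(k)}_{r,\ldots,r}$.
   Context: $K^{(k)}_{r,\ldots,r}$ denotes the complete $k$-partite $k$-uniform hypergraph with $k$ parts each of order $r$ (its edges are all $k$-sets containing exactly one vertex from each part). *)

(* Defs.v *)
From mathcomp Require Import all_boot.

Set Implicit Arguments.
Unset Strict Implicit.
Unset Printing Implicit Defensive.

(* V is only an ambient type: the vertex set is the explicit subset [verts],
   so that a subhypergraph may drop vertices as well as edges. *)
Record hypergraph (V : finType) := Hypergraph {
  verts : {set V};
  edges : {set {set V}};
  edges_sub : forall e, e \in edges -> e \subset verts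
}.

Definition uniform (V : finType) (k : nat) (G : hypergraph V) : Prop :=
  forall e, e \in edges G -> #|e| = k.

Definition subhypergraph (V : finType) (H G : hypergraph V) : Prop :=
  verts H \subset verts G /\ edges H \subset edges G.

(* Copies are not required to be induced. *)
Definition contains_copy (U V : finType) (K : hypergraph U) (G : hypergraph V)
    : Prop :=
  exists f : U -> V,
    [/\ {in verts K &, injective f},
        f @: verts K \subset verts G &
        forall e, e \in edges K -> f @: e \in edges G].

Section CompleteKPartite.
Variables k r : nat.

(* The vertex (i, j) is the j-th vertex of the i-th part. *)
Definition part (i : 'I_k) : {set 'I_k * 'I_r} := [set v | v.1 == i].

Definition complete_kpartite_edges : {set {set 'I_k * 'I_r}} :=
  [set e : {set 'I_k * 'I_r} | (#|e| == k) && [forall i, #|e :&: part i| == 1]].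

Lemma complete_kpartite_sub e :
  e \in complete_kpartite_edges -> e \subset [set: 'I_k * 'I_r].
Proof. by move=> _; apply: subsetT. Qed.

Definition complete_kpartite : hypergraph ('I_k * 'I_r)%type :=
  Hypergraph complete_kpartite_sub.

End CompleteKPartite.

(* Main.v *)
Require Import Defs.
From mathcomp Require Import all_boot all_order all_algebra.
From mathcomp Require Import reals exp zify.

Set Implicit Arguments.
Unset Strict Implicit.
Unset Printing Implicit Defensive.

Import Order.TTheory GRing.Theory Num.Theory.
Local Open Scope ring_scope.

(** Deletion method. Choose every edge of [G] independently with probability
    [p = m^(-1/q) / k!] and delete one edge from each surviving copy of
    [K_(r,...,r)]. The [r] disjoint edges [{f (i, j) | i}] determine a labelled
    copy [f], so there are at most [(m k!)^r] of them, each with [r^k] edges;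
    since [r^k = q (r - 1) + 1], the expected number [p^(r^k) (m k!)^r] of
    surviving copies is at most half the expected number [p m] of chosen
    edges. *)

(** * Random subsets of a finite set, each element kept independently with probability [p] *)

Section BernoulliSubset.
Variables (R : realFieldType) (T : finType) (p : R).

Definition bernoulli_weight (S : {set T}) : R :=
  \prod_x (if x \in S then p else 1 - p).

Lemma bernoulli_weight_ge0 S : 0 <= p <= 1 -> 0 <= bernoulli_weight S.
Proof.
case/andP=> p0 p1; apply: prodr_ge0 => x _.
by case: ifP => // _; rewrite subr_ge0.
Qed.

Lemma sum_bernoulli_weight_sub (D : {set T}) :
  \sum_(S : {set T} | D \subset S) bernoulli_weight S = p ^+ #|D|.
Proof.
(* Each factor is [p] on [D] and [1] elsewhere. Expanding the product over the sets [S] where the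
   summand [p] is taken, the summand [0] kills every [S] missing a point of [D]. *)
have -> : p ^+ #|D| = \prod_x (p + (if x \in D then 0 else 1 - p)).
  rewrite -prodr_const [RHS](bigID (mem D)) /= [X in _ = _ * X]big1 ?mulr1.
    by apply: eq_bigr => x ->; rewrite addr0.
  by move=> x /negPf->; rewrite addrC subrK.
rewrite bigA_distr big_mkcond; apply: eq_bigr => S _.
case: ifPn => [DS|/subsetPn[x xD xS]].
  by apply: eq_bigr => x _; case: ifPn => // xS; rewrite (contraNF (subsetP DS x)).
by rewrite (bigD1 x) //= (negPf xS) xD mul0r.
Qed.

Lemma sum_bernoulli_weight : \sum_(S : {set T}) bernoulli_weight S = 1.
Proof.
rewrite -[RHS](expr0 p) -(cards0 T) -sum_bernoulli_weight_sub.
by apply: eq_bigl => S; rewrite sub0set.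
Qed.

(** Linearity of expectation: exchange the two sums and use that [S] contains [D i] with probability
    [p ^+ #|D i|]. *)
Lemma sum_bernoulli_weight_card (I : finType) (A : {set I}) (D : I -> {set T}) :
  \sum_(S : {set T}) bernoulli_weight S * #|[set i in A | D i \subset S]|%:R =
  \sum_(i in A) p ^+ #|D i|.
Proof.
under [RHS]eq_bigr => i _ do rewrite -sum_bernoulli_weight_sub big_mkcond.
rewrite exchange_big /=; apply: eq_bigr => S _.
rewrite -big_mkcondr sumr_const -[RHS]mulr_natr; congr (_ * _%:R).
by apply: eq_card => i; rewrite inE.
Qed.

End BernoulliSubset.

(** * The deletion method for a family of sets of common size [N] *)

Section Alteration.
Variables (R : realFieldType) (T I : finType).
Variables (E : {set T}) (P : {set I}) (B : I -> {set T}) (N : nat) (p : R).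
Hypotheses (p01 : 0 <= p <= 1) (cardB : forall i, i \in P -> #|B i| = N).

(** The left side is the expectation of the right side, and some outcome is at least the mean. *)
Lemma exists_subset_few_contained :
  exists S : {set T},
    p * #|E|%:R - p ^+ N * #|P|%:R <=
      #|S :&: E|%:R - #|[set i in P | B i \subset S]|%:R.
Proof.
pose X (S : {set T}) : R := #|S :&: E|%:R - #|[set i in P | B i \subset S]|%:R.
set c := (X in exists _, X <= _).
have EX : \sum_(S : {set T}) bernoulli_weight p S * (X S - c) = 0.
  have EE : \sum_(x in E) p ^+ #|[set x]| = p * #|E|%:R.
    by under eq_bigr do rewrite cards1; rewrite sumr_const mulr_natr.
  have EB : \sum_(i in P) p ^+ #|B i| = p ^+ N * #|P|%:R.
    by rewrite mulr_natr -sumr_const; apply: eq_bigr => i /cardB->.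
  (* Seen through singletons, the kept elements of [E] are also counted by
     [sum_bernoulli_weight_card]. *)
  have SIE S : S :&: E = [set x in E | [set x] \subset S].
    by apply/setP => x; rewrite !inE sub1set andbC.
  under eq_bigr => S _ do rewrite !mulrBr SIE.
  rewrite !sumrB -!mulr_suml sum_bernoulli_weight !mul1r.
  by rewrite !sum_bernoulli_weight_card EE EB subrr.
have [S cX|noS] := pickP (fun S => c <= X S); first by exists S.
(* If every [X S] were below the mean [c], the nonnegative terms weight times [c - X S], which sum
   to 0, would all vanish. All weights would then be 0, but they sum to 1. *)
have w0 (S : {set T}) := bernoulli_weight_ge0 S p01.
have wX S : 0 <= bernoulli_weight p S * (c - X S).
  by rewrite mulr_ge0 // subr_ge0 ltW // ltNge noS.
have wX0 (S : {set T}) : bernoulli_weight p S = 0.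
  have /eqP : \sum_(S : {set T}) bernoulli_weight p S * (c - X S) = 0.
    apply: oppr_inj; rewrite oppr0 -[RHS]EX -sumrN.
    by apply: eq_bigr => U _; rewrite -mulrN opprB.
  rewrite psumr_eq0 // => /allP /(_ S (mem_index_enum _)) /=.
  by rewrite mulf_eq0 subr_eq0 (gt_eqF (_ : X S < c)) ?orbF ?ltNge ?noS // => /eqP.
have := sum_bernoulli_weight T p.
by rewrite big1 => [/esym/eqP|S _]; rewrite ?oner_eq0 ?wX0.
Qed.

(* Delete one element of every [B i] contained in the random set. *)
Lemma alteration :
  (0 < N)%N ->
  exists S : {set T},
    [/\ S \subset E,
        forall i, i \in P -> ~~ (B i \subset S) &
        p * #|E|%:R - p ^+ N * #|P|%:R <= #|S|%:R].
Proof.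
move=> N0; have [S leS] := exists_subset_few_contained.
pose bad := [set i in P | B i \subset S].
have [D DB cardD] : exists2 D : {set T},
    forall i, i \in bad -> exists2 x, x \in B i & x \in D & (#|D| <= #|bad|)%N.
  (* [g] picks one element per bad set, as an option with [None] for an empty [B i]; bad sets are
     nonempty since [0 < N]. *)
  pose g i := [pick x in B i].
  exists [set x | Some x \in g @: bad].
    move=> i ib; have: (0 < #|B i|)%N by rewrite cardB //; case/setIdP: ib.
    rewrite card_gt0 => /set0Pn[y yB].
    have : g i \in g @: bad by rewrite imset_f.
    rewrite /g; case: pickP => [x xB gx|/(_ y)]; last by rewrite yB.
    by exists x => //; rewrite inE.
  apply: leq_trans (leq_imset_card g bad).
  rewrite -(card_imset _ Some_inj); apply: subset_leq_card.
  by apply/subsetP => _ /imsetP[x xg ->]; rewrite inE in xg.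
exists ((S :&: E) :\: D); split.
- by rewrite subDset subsetU // subsetIr orbT.
- move=> i iP; apply/negP; rewrite subsetD subsetI => /andP[/andP[BS _] /pred0P BD].
  have [|x xB xD] := DB i; first by rewrite inE iP.
  by have := BD x; rewrite /= xB xD.
apply: le_trans leS _; rewrite lerBlDr -natrD ler_nat.
rewrite -(cardsID D (S :&: E)) addnC leq_add2l.
by apply: leq_trans cardD; rewrite subset_leq_card // subsetIr.
Qed.

End Alteration.

(** * Labelled copies and their number *)

Section Copies.
Variables (k r : nat) (V : finType) (G : hypergraph V).

(** An edge encoded as the graph of a choice function, so that [r ^ k] edges can be counted as
    functions. *)
Definition transversal_edge (g : {ffun 'I_k -> 'I_r}) : {set 'I_k * 'I_r} :=
  [set (i, g i) | i : 'I_k].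

Lemma mem_transversal_edge g i j :
  ((i, j) \in transversal_edge g) = (j == g i).
Proof. by apply/imsetP/eqP => [[i' _ [-> ->]]|->] //; exists i. Qed.

Lemma transversal_edge_inj : injective transversal_edge.
Proof.
move=> g h gh; apply/ffunP => i; apply/eqP.
by rewrite -mem_transversal_edge -gh mem_transversal_edge.
Qed.

Lemma transversal_edgeP g :
  transversal_edge g \in edges (complete_kpartite k r).
Proof.
rewrite inE card_imset ?card_ord ?eqxx => [|i j [] //].
apply/forallP => i; apply/cards1P; exists (i, g i); apply/setP => -[i' j].
rewrite in_setI mem_transversal_edge !inE /= xpair_eqE andbC.
by case: eqP => // ->.
Qed.

Definition copies : {set {ffun 'I_k * 'I_r -> V}} :=
  [set f : {ffun _} | injectiveb f &
    [forall g : {ffun _}, f @: transversal_edge g \in edges G]].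

Definition copy_edges (f : {ffun 'I_k * 'I_r -> V}) : {set {set V}} :=
  [set f @: transversal_edge g | g : {ffun 'I_k -> 'I_r}].

Lemma card_copy_edges f : f \in copies -> #|copy_edges f| = (r ^ k)%N.
Proof.
rewrite inE => /andP[/injectiveP finj _].
rewrite card_imset ?card_ffun ?card_ord // => g h /(imset_inj finj).
exact: transversal_edge_inj.
Qed.

Lemma contains_copy_copies :
  contains_copy (complete_kpartite k r) G ->
  exists2 f, f \in copies & copy_edges f \subset edges G.
Proof.
case=> f [finj _ fE]; exists (finfun f).
  rewrite inE; apply/andP; split.
    by apply/injectiveP => u v; rewrite !ffunE; apply: finj; rewrite inE.
  apply/forallP => g; rewrite (eq_imset _ (ffunE _)).
  exact/fE/transversal_edgeP.
apply/subsetP => _ /imsetP[g _ ->]; rewrite (eq_imset _ (ffunE _)).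
exact/fE/transversal_edgeP.
Qed.

(* A copy is determined by the [r] ordered edges [f (_, j)]. *)
Lemma card_copies :
  uniform k G -> (#|copies| <= (#|edges G| * k`!) ^ r)%N.
Proof.
move=> Gk.
(* The orderings of edges: [k!] for each edge, since it has order [k]. *)
pose A := [set h : {ffun 'I_k -> V} | injectiveb h & h @: setT \in edges G].
have cardA : (#|A| <= #|edges G| * k`!)%N.
  pose Ae (e : {set V}) := [set h in ffun_on (mem e) | injectiveb (h : {ffun 'I_k -> V})].
  have AE : A \subset \bigcup_(e in edges G) Ae e.
    apply/subsetP => h; rewrite inE => /andP[hinj hE].
    apply/bigcupP; exists (h @: setT) => //; rewrite inE hinj andbT.
    by apply/ffun_onP => i; rewrite imset_f.
  apply: leq_trans (subset_leq_card AE) _.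
  apply: leq_trans (_ : \sum_(e in edges G) #|Ae e| <= _)%N.
    elim/big_rec2: _ => [|e n B _ leBn]; first by rewrite cards0.
    by rewrite (leq_trans (leq_card_setU _ _)) // leq_add2l.
  rewrite -sum_nat_const leq_sum // => e /Gk ek.
  by rewrite card_inj_ffuns_on ek card_ord ffactnn.
pose col (f : {ffun 'I_k * 'I_r -> V}) := [ffun j => [ffun i => f (i, j)]].
have col_inj : injective col.
  move=> f f' eqf; apply/ffunP => -[i j].
  by have /ffunP/(_ j) := eqf; rewrite !ffunE => /ffunP/(_ i); rewrite !ffunE.
rewrite -(card_imset _ col_inj).
apply: leq_trans (_ : #|@ffun_on_mem 'I_r _ (mem A)| <= _)%N; last first.
  by rewrite card_ffun_on card_ord; case: (r) => // n; rewrite leq_exp2r.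
apply: subset_leq_card; apply/subsetP => _ /imsetP[f + ->].
rewrite inE => /andP[/injectiveP finj /forallP fE].
apply/ffun_onP => j; rewrite !ffunE inE; apply/andP; split.
  by apply/injectiveP => i i'; rewrite !ffunE => /finj[].
(* Column [j] is the transversal edge of the constant choice [j], so its image is an edge of [G]. *)
suff <- : f @: transversal_edge [ffun=> j] = [ffun i => f (i, j)] @: setT by [].
apply/setP => v; apply/imsetP/imsetP => [[_ /imsetP[i _ ->] ->]|[i _ ->]].
  by exists i; rewrite ?inE ?ffunE.
by exists (i, j); rewrite ?mem_transversal_edge ?ffunE.
Qed.

End Copies.

(** * Choice of parameters: [M] is the number of edges, [c = k!], [x = M^(-1/Q)] and [p = x / c] *)

Lemma alteration_bound (F : realFieldType) (x M c : F) (Q s N r : nat) :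
  0 <= x -> 0 <= M -> 2 <= c -> x ^+ Q * M = 1 ->
  N = (Q * s).+1 -> r = s.+1 -> (r.+2 <= N)%N ->
  1 / (2 * c) * (M * x) <= x / c * M - (x / c) ^+ N * (M * c) ^+ r.
Proof.
move=> x0 M0 c2 xM NE rE rN.
have c0 : 0 < c by apply: lt_le_trans c2.
(* With [N = Q s + 1] and [r = s + 1], [x^N M^r = x M (x^Q M)^s = x M]. *)
have -> : (x / c) ^+ N * (M * c) ^+ r = M * x * (c ^+ r / c ^+ N).
  rewrite exprMn exprVn exprMn mulrACA mulrA (mulrAC _ _ (c ^+ r)).
  rewrite [RHS]mulrA; congr (_ * _ / _).
  rewrite NE rE !exprS exprM mulrACA -exprMn xM expr1n mulr1.
  by rewrite mulrC.
have -> : x / c * M = M * x * c^-1 by rewrite mulrAC (mulrC M).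
rewrite -mulrBr mulrC ler_wpM2l ?mulr_ge0 //.
(* Since [2 <= c], [2 c * c^r <= c^(r+2) <= c^N]: the deleted part is at most half of [M x / c]. *)
have cN : c ^+ r / c ^+ N <= (2 * c)^-1.
  rewrite ler_pdivrMr ?exprn_gt0 // mulrC ler_pdivlMr ?mulr_gt0 //.
  apply: le_trans (ler_weXn2l _ rN); last by apply: le_trans c2; rewrite ler1n.
  rewrite mulrC -mulrA -exprS !exprS; apply: ler_wpM2r => //.
  by rewrite mulr_ge0 ?exprn_ge0 // ltW.
rewrite lerBrDr; apply: le_trans (lerD (lexx _) cN) _.
by rewrite div1r invfM -mulrDl -[2^-1]mul1r -splitr mul1r.
Qed.

Theorem theorem3p4 (R : realType) (k r : nat) (hk : (2 <= k)%N) (hr : (2 <= r)%N)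
    (q : R) (hq : q = (r%:R ^+ k - 1) / (r%:R - 1))
    (V : finType) (G : hypergraph V) (hG : uniform k G)
    (m : nat) (hm : #|edges G| = m) :
  exists H : hypergraph V,
    [/\ subhypergraph H G,
        1 / (2 * k`!%:R) * (m%:R `^ ((q - 1) / q)) <= #|edges H|%:R :> R &
        ~ contains_copy (complete_kpartite k r) H].
Proof.
(* [Q] is [q] as a natural number, a geometric sum, so that [q]-th powers become natural powers. *)
pose Q := (\sum_(i < k) r ^ i)%N; pose N := (r ^ k)%N.
have r1 : r%:R - 1 != 0 :> R by rewrite subr_eq0 pnatr_eq1; case: (r) hr => [|[]].
have {hq}qE : q = Q%:R.
  rewrite hq subrX1 mulrAC divff // mul1r /Q natr_sum.
  by apply: eq_bigr => i _; rewrite natrX.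
have N0 : (0 < N)%N by rewrite expn_gt0 (ltn_trans _ hr).
have NE : N = (Q * r.-1).+1 by rewrite mulnC -predn_exp prednK.
have rN : (r.+2 <= N)%N.
  apply: leq_trans (_ : r ^ 2 <= _)%N; last by rewrite leq_exp2l.
  nia.
have Q1 : (1 < Q)%N by move: rN; rewrite NE; nia.
have q0 : 0 < q by rewrite qE ltr0n ltnW.
pose x : R := m%:R `^ (- q^-1); pose c : R := k`!%:R.
have x0 : 0 <= x := powR_ge0 _ _.
have c2 : 2 <= c by rewrite ler_nat (leq_trans hk) ?fact_geq.
have c0 : 0 < c by apply: lt_le_trans c2.
have [p p01 pP] : exists2 p : R, 0 <= p <= 1 &
    1 / (2 * c) * (m%:R `^ ((q - 1) / q)) <=
    p * m%:R - p ^+ N * ((m%:R * c) ^+ r).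
  (* For [m = 0] the bound is 0: the exponent [(q - 1) / q] is nonzero as [1 < Q], whereas a zero
     exponent would give the value 1. *)
  have [->|m0] := posnP m.
    exists 0; rewrite ?lexx ?ler01 // powR0 ?mulr0 ?mul0r ?expr0n.
      by rewrite eqn0Ngt N0 mul0r subr0.
    by rewrite mulf_neq0 ?invr_eq0 ?(gt_eqF q0) // subr_eq0 qE pnatr_eq1 gtn_eqF.
  have m0R : m%:R != 0 :> R by rewrite pnatr_eq0 -lt0n.
  exists (x / c).
    rewrite divr_ge0 ?(ltW c0) // ler_pdivrMr // mul1r.
    apply: le_trans (_ : 1 <= _); last by apply: le_trans c2; rewrite ler1n.
    by rewrite -(powRr0 m%:R) ler_powR ?ler1n // oppr_le0 invr_ge0 ltW.
  have -> : m%:R `^ ((q - 1) / q) = m%:R * x.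
    rewrite mulrBl divff ?gt_eqF // mul1r powRD ?powRr1 //.
    by apply/implyP.
  apply: (@alteration_bound _ _ _ _ Q r.-1) => //; last by rewrite prednK // ltnW.
  rewrite -powR_mulrn // -powRrM -qE mulNr mulVf ?gt_eqF //.
  by rewrite powR_inv1 // mulVf.
(* The ground set is [{set V}], and the sets to be destroyed are the edge sets of the labelled
   copies in [G]. *)
have [S [SE SB Scard]] := alteration (edges G) p01 (@card_copy_edges k r V G) N0.
have SV e : e \in S -> e \subset verts G.
  by move=> eS; apply: edges_sub; apply: (subsetP SE).
exists (Hypergraph SV); split => //=.
  apply: le_trans pP (le_trans _ Scard).
  rewrite hm lerD2l lerN2 ler_wpM2l //; first by rewrite exprn_ge0; case/andP: p01.
  by rewrite -natrM -natrX ler_nat -hm card_copies.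
(* As [S] lies in [edges G], a copy in the new hypergraph is one in [G] with all its edges in [S],
   which [SB] excludes. *)
move=> /contains_copy_copies[f fc /=]; apply/negP/SB.
move: fc; rewrite !inE => /andP[-> /forallP fS].
by apply/forallP => g; apply: (subsetP SE).
Qed.
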